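(* Let $V$ be a finite set with $m=|V|$ and let $(V,B)$ be a quasi-symmetric $2$-$(m,S,\Lambda)$ design with intersection numbers $\beta<\alpha$ (equivalently a coherent configuration of type $(2,2;3)$ with fibers $V,B$). Suppose there is a map $i:V\cup B\to\mathbb{R}^{m-1}$ such that (1) $i(V)$ is the vertex set of a regular simplex with $m$ vertices; (2) $i(B)$ is a scaling of the spherical embedding of the block graph in $\mathbb{R}^{m-1}$ (i.e. there are $o\in\mathbb{R}^{m-1}$, $c>0$ and a linear isometry $\varphi$ from the $r$-eigenspace of the block graph onto $\mathbb{R}^{m-1}$ with $i(b)=o+c\,\varphi(E_re_b)$ for all $b\in B$); (3) for $v\in V$, $b\in B$ the distance $\|i(v)-i(b)\|$ depends only on whether $v\in b$; and such that $i(V\cup B)$ is a two-distance set, i.e. $|A(i(V\cup B),i(V\cup B))|=2$. Then this is Lisoněk's example: $m=9$ and, up to replacing every block by its complement in $V$, $B$ is the set of all $2$-element subsets of $V$ (the $2$-$(9,2,1)$ design).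
   Context: For finite $X,Y\subset\mathbb{R}^d$, $A(X,Y)=\{\|x-y\|:x\in X,y\in Y,x\neq y\}$. A $2$-$(m,S,\Lambda)$ design is a collection $B$ of $S$-subsets of an $m$-set $V$ with every $2$-subset of $V$ in exactly $\Lambda$ blocks; quasi-symmetric means $|b\cap b'|$ for distinct blocks takes exactly two values $\beta<\alpha$. The block graph has vertex set $B$, $b\sim b'$ iff $|b\cap b'|=\alpha$; it is strongly regular with eigenvalues $k>r>s$; $E_r$ denotes the orthogonal projection of $\mathbb{R}^B$ onto the $r$-eigenspace (of dimension $m-1$), and $e_b$ the standard basis of $\mathbb{R}^B$. Lisoněk's example: $X_1=\{-e_i+\frac13\sum_{k=1}^9e_k\}$, $X_2=\{e_i+e_j: i<j\}$ in the hyperplane $\sum x_i=2$ of $\mathbb{R}^9$, a $45$-point two-distance set in $\mathbb{R}^8$ with distances $\sqrt2,2$, coming from the design of all $2$-subsets of a $9$-set. *)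

(* Defs.v *)
From mathcomp Require Export all_boot all_order all_algebra finmap reals.

Set Implicit Arguments.
Unset Strict Implicit.
Unset Printing Implicit Defensive.

Import Order.TTheory GRing.Theory Num.Theory.
Local Open Scope ring_scope.

Section Euclidean.
Variables (R : realType) (d : nat).

(* MathComp-Analysis equips 'rV[R]_d with the sup norm, hence this one. *)
Definition enorm (u : 'rV[R]_d) : R := Num.sqrt (\sum_j u 0 j ^+ 2).

Definition edist (x y : 'rV[R]_d) : R := enorm (x - y).

Definition distance_set (X Y : {fset 'rV[R]_d}) : {fset R} :=
  [fset edist p.1 p.2 | p in (X `*` Y)%fset & p.1 != p.2]%fset.

Definition two_distance_set (X : {fset 'rV[R]_d}) : Prop :=
  #|` distance_set X X| = 2%N.

Definition affinely_independent (I : finType) (p : I -> 'rV[R]_d) : Prop :=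
  forall a : I -> R, \sum_x a x *: p x = 0 -> \sum_x a x = 0 ->
    forall x, a x = 0.

Definition regular_simplex (I : finType) (p : I -> 'rV[R]_d) : Prop :=
  affinely_independent p /\
  exists l : R, forall x y, x != y -> edist (p x) (p y) = l.

(* Acts on row vectors: u *m orth_proj U is the orthogonal projection of u
   onto the row space of U; the rows of kermx U^T span its complement. *)
Definition orth_proj (U : 'M[R]_d) : 'M[R]_d := proj_mx U (kermx U^T).

End Euclidean.

Definition is_2design (V : finType) (m S Lambda : nat) (B : {set {set V}}) :
    Prop :=
  [/\ #|V| = m,
      forall b, b \in B -> #|b| = S
    & forall T : {set V}, #|T| = 2%N -> #|[set b in B | T \subset b]| = Lambda].

Definition quasi_symmetric (V : finType) (B : {set {set V}}) (beta alpha : nat) :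
    Prop :=
  [/\ (beta < alpha)%N,
      forall b b', b \in B -> b' \in B -> b != b' ->
        #|b :&: b'| = beta \/ #|b :&: b'| = alpha,
      exists b b', [/\ b \in B, b' \in B, b != b' & #|b :&: b'| = beta]
    & exists b b', [/\ b \in B, b' \in B, b != b' & #|b :&: b'| = alpha]].

Definition quasi_symmetric_2design (V : finType) (m S Lambda beta alpha : nat)
    (B : {set {set V}}) : Prop :=
  is_2design m S Lambda B /\ quasi_symmetric B beta alpha.

Notation block B := {b : {set _} | b \in B}.

Section BlockGraph.
Variables (R : realType) (V : finType) (B : {set {set V}}) (alpha : nat).

Definition block_adj (b b' : block B) : bool :=
  (b != b') && (#|val b :&: val b'| == alpha).

(* R^B is 'rV[R]_#|{: block B}|, indexed through enum_rank and enum_val. *)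
Definition block_adj_mx : 'M[R]_#|{: block B}| :=
  \matrix_(x, y) (block_adj (enum_val x) (enum_val y))%:R.

Definition block_graph_eigenvalues (k r s : R) : Prop :=
  [/\ s < r, r < k
    & forall a, eigenvalue block_adj_mx a = (a \in [:: k; r; s])].

Definition basis_vec (b : block B) : 'rV[R]_#|{: block B}| :=
  delta_mx 0 (enum_rank b).

Definition scaled_spherical_embedding (d : nat) (r : R)
    (f : block B -> 'rV[R]_d) : Prop :=
  let W := eigenspace block_adj_mx r in
  exists (o : 'rV[R]_d) (c : R)
         (phi : {linear 'rV[R]_#|{: block B}| -> 'rV[R]_d}),
    [/\ 0 < c,
        forall u, (u <= W)%MS -> enorm (phi u) = enorm u,
        forall y, exists2 u, (u <= W)%MS & phi u = y
      & forall b, f b = o + c *: phi (basis_vec b *m orth_proj W)].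

End BlockGraph.

(* Main.v *)
Require Import Defs.
From mathcomp Require Import zify ring.

Set Implicit Arguments.
Unset Strict Implicit.
Unset Printing Implicit Defensive.

Import Order.TTheory GRing.Theory Num.Theory.
Local Open Scope ring_scope.

(** Let [l] be the edge length of the simplex and let [D1], [D0] be the squared
    distances from a block to its points and to the other points.  In affine
    coordinates with respect to the simplex, the image of a block [b] is
    [(1 - S t) / m + t [v \in b]] with [t = (D0 - D1) / l^2], so two blocks are
    at squared distance [l^2 t^2 (S - |b :&: b'|)]; moreover [t != 0] because the
    spherical embedding spans the space.  Hence the two distances are those
    between blocks, and [l^2], [D0], [D1] are among them.  This forces
    [{S - alpha, S - beta} = {d^2, d^2 + d}] for an integer [d = +- (alpha - beta)]
    and [(S1 - 2 d) (m - S1) = (m + 1) d^2] for [S1 = S] or [S1 = m - S].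

    Put [w = d (d + 1)], [u = S1 - w - d] and [q = m - u - 2 w].  Then [u q = w^2]
    and the count of blocks reads [n (m (2 w + 1 - u) - q) = u m (m - 1)], whose
    integrality forces [u = 2 w], that is [n = m (m - 1) / 2].  The incidence
    matrix between pairs and blocks is then square; its inverse, read off
    from the two intersection numbers, yields one more equation on the
    parameters, which leaves only [d = 1], [m = 9]. *)

(** * Arithmetic of the parameters *)

(** Divide [u] and [w] by their gcd [k], leaving coprime [a] and [b]. Then [a * q = b ^+ 2 * k]
    forces [a] to divide [k], and [g] is the quotient. *)
Lemma square_factorization (u w q : int) : 0 < u -> 0 < w -> u * q = w ^+ 2 ->
  exists g a b : int, [/\ 0 < g, 0 < a, 0 < b, coprimez a b
    & [/\ u = g * a ^+ 2, w = g * a * b & q = g * b ^+ 2]].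
Proof.
move=> u0 w0 uq.
have k0 : 0 < gcdz u w by rewrite /gcdz ltz_nat gcdn_gt0; lia.
set k := gcdz u w in k0.
have [a ua] : exists a, u = a * k by apply/dvdzP/dvdz_gcdl.
have [b wb] : exists b, w = b * k by apply/dvdzP/dvdz_gcdr.
have a0 : 0 < a by nia.
have b0 : 0 < b by nia.
have cab : coprimez a b.
  have : gcdz a b * k = k.
    by rewrite -[RHS]/(gcdz u w) ua wb -mulz_gcdl gtz0_abs.
  by rewrite /coprimez => h; apply/eqP; nia.
have aq : a * q = b ^+ 2 * k.
  by apply: (mulIf (lt0r_neq0 k0)); rewrite mulrAC -ua uq wb; ring.
have : (a %| b ^+ 2 * k)%Z by rewrite -aq dvdz_mulr.
rewrite Gauss_dvdzr; last by rewrite coprimezXr.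
move=> /dvdzP[g kg].
exists g, a, b; split=> //; first by nia.
by split; [rewrite ua kg; ring | rewrite wb kg; ring |
  apply: (mulfI (lt0r_neq0 a0)); rewrite aq kg; ring].
Qed.

(** In the factored parameters [m = M = g (a + b)^2], and the count becomes [n E = a M (M - 1)] with
    [E = a + 2 b + h M] and [h = 2 b - a]. The sign of [h] decides: [h < 0] makes [E] negative,
    [h > 0] contradicts divisibility by [E], and [h = 0] is the claim. *)
Lemma tight_of_integrality (n m u w q : int) :
  0 < n -> 0 < u -> 0 < w -> u * q = w ^+ 2 -> m = u + 2 * w + q ->
  n * (m * (2 * w + 1 - u) - q) = u * m * (m - 1) -> u = 2 * w.
Proof.
move=> n0 u0 w0 uq em nD.
have [g [a [b [g0 a0 b0 cab [eu ew eq]]]]] := square_factorization u0 w0 uq.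
suff : a = 2 * b by rewrite eu ew => ->; ring.
have {cab} [x [y xy]] : exists x y, x * a + y * b = 1.
  by case/coprimezP: cab => -[x y] /= xy; exists x, y.
have [M eM] : exists M, M = g * (a + b) ^+ 2 by exists (g * (a + b) ^+ 2).
have [h eh] : exists h, h = 2 * b - a by exists (2 * b - a).
have [E eE] : exists E, E = a + 2 * b + h * M by exists (a + 2 * b + h * M).
have mM : m = M by rewrite em eu ew eq eM; ring.
have M_gt : a + 2 * b < M by rewrite eM; clear -g0 a0 b0; nia.
have M_ge : 4 * g * a * b <= M.
  rewrite -subr_ge0; have -> : M - 4 * g * a * b = g * (a - b) ^+ 2.
    by rewrite eM; ring.
  by rewrite mulr_ge0 ?sqr_ge0 // ltW.
have DE : m * (2 * w + 1 - u) - q = g * a * E.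
  by rewrite mM eu ew eq eE eh eM; ring.
have nE : n * E = a * M * (M - 1).
  have ga0 : g * a != 0 by rewrite mulf_neq0 ?lt0r_neq0.
  by apply: (mulfI ga0); rewrite mulrCA -DE nD mM eu; ring.
have E0 : 0 < E.
  have : 0 < n * E by rewrite nE; apply: mulr_gt0; [apply: mulr_gt0|]; lia.
  by rewrite pmulr_rgt0.
clear eu ew eq mM DE nD em uq u0 w0.
case: (ltrgt0P h) => [hp|hn|hz]; last by clear -eh hz; lia.
- exfalso.
  (* [E] divides [a * M * (M - 1)] and is prime to [a + b], and [h * M] is
     [- (a + 2 * b)] modulo [E]; hence [E] divides [4 * g * a * b < E]. *)
  have cE : coprimez E (a + b).
    apply/coprimezP; exists (y - x, x - (y - x) * (h * g * (a + b) + 1)) => /=.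
    by rewrite -[RHS]xy eE eM; ring.
  have dE : (E %| (a + b) ^+ 2 * (g * a * (M - 1)))%Z.
    by apply/dvdzP; exists n; rewrite nE eM; ring.
  rewrite Gauss_dvdzr in dE; last by rewrite coprimezXr.
  have /dvdzP[j ej] : (E %| 4 * g * a * b)%Z.
    have -> : 4 * g * a * b = g * a * E - h * (g * a * (M - 1)).
      by rewrite eE eh; ring.
    by rewrite rpredB // dvdz_mull.
  have gab0 : 0 < 4 * g * a * b by rewrite !mulr_gt0.
  have j1 : 0 < j by rewrite ej in gab0; rewrite pmulr_lgt0 in gab0.
  have E_le : E <= 4 * g * a * b by rewrite ej; clear -j1 E0; nia.
  have : M <= h * M by clear -hp M_gt a0 b0; nia.
  by clear -E_le M_ge eE a0 b0; lia.
- have : M <= - h * M by clear -hn M_gt a0 b0; nia.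
  by clear -E0 eE M_gt; lia.
Qed.

Section TightDesignArithmetic.
Variables (m S n d : int).
(** The two intersection numbers: blocks meeting in [al] points are as far apart as two vertices of
    the simplex. The sign of [d] tells which of the two is larger. *)
Let al := S - d ^+ 2.
Let be := S - d ^+ 2 - d.

Lemma tight_parameters (S1 : int) :
  d != 0 -> d != -1 -> 0 < n -> 1 < m -> S1 = S \/ S1 = m - S ->
  (S1 - 2 * d) * (m - S1) = (m + 1) * d ^+ 2 ->
  n * (S ^+ 2 * (S - 1) ^+ 2 + (1 - al - be) * S ^+ 2 * (m - 1)
       + al * be * m * (m - 1)) = m * (m - 1) * (S - al) * (S - be) ->
  [/\ 2 * m = 9 * (d * (d + 1)), S1 = 3 * d ^+ 2 + 4 * d
    & 2 * n = m * (m - 1)].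
Proof.
move=> d0 d1 n0 m1 hS1 geo E1.
have [w ew] : exists w, w = d * (d + 1) by exists (d * (d + 1)).
have [u eu] : exists u, u = S1 - w - d by exists (S1 - w - d).
have [q eq] : exists q, q = m - u - 2 * w by exists (m - u - 2 * w).
have w0 : 0 < w.
  have [dp|dn] : 0 < d \/ d + 1 < 0 by clear -d0 d1; lia.
    by rewrite ew mulr_gt0 // ltr_wpDr.
  by rewrite ew nmulr_rgt0 //; clear -dn; lia.
have mu : m * u = (u + w) ^+ 2.
  have -> : m * u = (S1 - 2 * d) * (m - S1) - (m + 1) * d ^+ 2
                    + d ^+ 2 + S1 * (S1 - 2 * d) by rewrite eu ew; ring.
  by rewrite geo eu ew; ring.
have u0 : 0 < u.
  suff : 0 < m * u by rewrite pmulr_rgt0 // (lt_trans _ m1).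
  rewrite mu exprn_even_gt0 //=; apply/eqP => uw.
  have : m * u = 0 by rewrite mu uw; ring.
  by move/eqP; rewrite mulf_eq0; clear -uw w0 m1; lia.
have uq : u * q = w ^+ 2.
  have -> : u * q = m * u - u ^+ 2 - 2 * w * u by rewrite eq; ring.
  by rewrite mu; ring.
have em : m = u + 2 * w + q by rewrite eq; ring.
have eS1 : S1 = u + w + d by rewrite eu; ring.
have nD : n * (m * (2 * w + 1 - u) - q) = u * m * (m - 1).
  have dw0 : d ^+ 2 * w != 0 by rewrite mulf_neq0 ?expf_neq0 // lt0r_neq0.
  apply: (mulfI dw0).
  (* This identity holds only modulo [u q = w^2]. The long factor below is the cofactor of
     [u q - w^2] in the difference of the two sides; it is the same for [S] and [m - S], since
     complementing the blocks preserves the count. *)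
  have Br : u * (S ^+ 2 * (S - 1) ^+ 2 + (1 - al - be) * S ^+ 2 * (m - 1)
       + al * be * m * (m - 1)) = d ^+ 2 * w * (m * (2 * w + 1 - u) - q).
    have eS : S = u + w + d \/ S = m - (u + w + d) by clear -hS1 eS1; lia.
    apply/eqP; rewrite -subr_eq0; apply/eqP.
    transitivity ((u * q - w ^+ 2) *
      (u ^+ 2 * (q - d) - u * w ^+ 2 + 3 * d * u * q + 2 * u * w * (d - 1)
       + 3 * d * u + 4 * w ^+ 2 - 4 * d * w + 2 * (w - d) * (q + 1)));
      last by rewrite uq subrr mul0r.
    by case: eS => eS; rewrite /al /be eS em ew; ring.
  by rewrite mulrCA -Br mulrCA E1 /al /be ew; ring.
have u2 := tight_of_integrality n0 u0 w0 uq em nD.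
have q2 : 2 * q = w.
  by apply: (mulIf (lt0r_neq0 w0)); rewrite -expr2 -uq u2; ring.
split.
- by rewrite -ew; clear -em u2 q2; lia.
- by rewrite eS1 u2 ew; ring.
(* With [u = 2 w] the factor of [n] in [nD] collapses to [m - q = 2 u]. *)
- apply: (mulfI (lt0r_neq0 u0)).
  transitivity (n * (m * (2 * w + 1 - u) - q)); last by rewrite nD; ring.
  by rewrite em u2; ring.
Qed.

(** Both candidates for [S] turn the last equation into the same polynomial in [d], whose integer
    roots are [0], [1] and [-1]. *)
Lemma tight_parameter_eq1 (S1 : int) :
  d != 0 -> d != -1 -> S1 = S \/ S1 = m - S ->
  2 * m = 9 * (d * (d + 1)) -> S1 = 3 * d ^+ 2 + 4 * d ->
  S * (S - 2) * (2 * S - 1 - al - be) =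
    (m - 2) * (S * (al + be - 1) - 2 * al * be) -> d = 1.
Proof.
move=> d0 d1 hS1 em eS1 E2.
have : (3 * d + 4) * d ^+ 2 * (d - 1) * (d + 1) = 0.
  (* Doubling keeps the coefficients integral, as [m] is known only through [2 * m]. *)
  pose s := 2 * S.
  have eS : s = 2 * (3 * d ^+ 2 + 4 * d) \/ s = d * (3 * d + 1).
    by rewrite /s; clear -hS1 em eS1; lia.
  have : s * (s - 4) * (2 * d ^+ 2 + d - 1) = (2 * m - 4) *
      (s * (s - 2 * d ^+ 2 - d - 1)
       - (s - 2 * d ^+ 2) * (s - 2 * d ^+ 2 - 2 * d)).
    transitivity (4 * (S * (S - 2) * (2 * S - 1 - al - be))).
      by rewrite /s /al /be; ring.
    by rewrite E2 /s /al /be; ring.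
  move/eqP; rewrite em -subr_eq0 => /eqP E0.
  have two0 : (-2 : int) != 0 by [].
  apply: (mulfI two0); rewrite mulr0 -E0.
  by case: eS => ->; ring.
move=> /eqP; rewrite !mulf_eq0; lia.
Qed.
End TightDesignArithmetic.

(** * Counting in designs *)

Lemma mulr2_bin2 (k : nat) : 2 * ('C(k, 2))%:Z = k%:Z * (k%:Z - 1).
Proof.
elim: k => [|k IH]; first by rewrite bin0n mulr0 mul0r.
by rewrite binS bin1 PoszD mulrDr IH; lia.
Qed.

(** A one-sided inverse of a square matrix is two-sided; here rows and columns are indexed by
    different types of equal cardinality. *)
Lemma scaled_inverse_sum_sym (F : fieldType) (I J : finType) (c : F)
    (f : I -> J -> F) (g : J -> I -> F) : #|I| = #|J| -> c != 0 ->
  (forall i i', \sum_j f i j * g j i' = c * (i == i')%:R) ->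
  forall j j', \sum_i g j i * f i j' = c * (j == j')%:R.
Proof.
move=> IJ c0 fg j j'.
pose A := \matrix_(x < #|I|, y < #|J|) (c^-1 * f (enum_val x) (enum_val y)).
pose C := \matrix_(y < #|J|, x < #|I|) g (enum_val y) (enum_val x).
have AC : A *m C = 1%:M.
  apply/matrixP => x x'; rewrite !mxE.
  transitivity (c^-1 * \sum_j f (enum_val x) j * g j (enum_val x')).
    rewrite mulr_sumr (reindex _ (onW_bij _ (@enum_val_bij J))) /=.
    by apply: eq_bigr => y _; rewrite !mxE mulrA.
  by rewrite fg mulKf // (inj_eq enum_val_inj).
have CA : C *m A = 1%:M.
  by move: A C AC; rewrite IJ => A C; apply: mulmx1C.
move/matrixP/(_ (enum_rank j) (enum_rank j')): CA; rewrite !mxE.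
rewrite (inj_eq enum_rank_inj) => <-.
rewrite mulr_sumr (reindex _ (onW_bij _ (@enum_val_bij I))) /=.
by apply: eq_bigr => x _; rewrite !mxE !enum_rankK mulrCA mulVKf // mulrC.
Qed.

Lemma scaled_inverse_sum_symz (I J : finType) (c : int)
    (f : I -> J -> int) (g : J -> I -> int) : #|I| = #|J| -> c != 0 ->
  (forall i i', \sum_j f i j * g j i' = c * (i == i')%:R) ->
  forall j j', \sum_i g j i * f i j' = c * (j == j')%:R.
Proof.
move=> IJ c0 fg j j'; apply: (@intr_inj rat).
rewrite rmorph_sum rmorphM rmorph_nat /=.
under eq_bigr => i _ do rewrite rmorphM.
apply: (@scaled_inverse_sum_sym rat I J _ (fun i j => (f i j)%:~R)
  (fun j i => (g j i)%:~R)) => // [|i i']; first by rewrite intr_eq0.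
have /(congr1 (fun z : int => z%:~R : rat)) := fg i i'.
rewrite rmorphM rmorph_nat => <-.
by rewrite rmorph_sum; apply: eq_bigr => k _; rewrite rmorphM.
Qed.

Section Design.
Variables (V : finType) (B : {set {set V}}) (S Lambda : nat).
Hypothesis sizeB : forall b, b \in B -> #|b| = S.
Hypothesis pairB : forall T : {set V}, #|T| = 2%N ->
  #|[set b in B | T \subset b]| = Lambda.
Local Notation m := #|V|.

(** Double counting of the pairs [T] contained in both [X] and a block. *)
Lemma sum_bin2_inter (X : {set V}) :
  (\sum_(b in B) 'C(#|b :&: X|, 2) = 'C(#|X|, 2) * Lambda)%N.
Proof.
rewrite -cards_draws -sum1_card big_distrl /=.
transitivity (\sum_(b in B)
    \sum_(T in [set A : {set V} | A \subset X & #|A| == 2%N])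
      (T \subset b : nat)).
  apply: eq_bigr => b bB; rewrite -cards_draws -sum1_card big_mkcond /=.
  rewrite [RHS]big_mkcond /=; apply: eq_bigr => T _.
  rewrite !inE subsetI.
  by case: (T \subset b); case: (T \subset X); case: (_ == _).
rewrite exchange_big /=; apply: eq_bigr => T; rewrite inE => /andP[_ /eqP T2].
rewrite -(pairB T2) mul1n -sum1_card [RHS]big_mkcond [LHS]big_mkcond /=.
by apply: eq_bigr => b _; rewrite inE; case: (b \in B); case: (_ \subset _).
Qed.

Lemma block_count : (#|B| * 'C(S, 2) = 'C(m, 2) * Lambda)%N.
Proof.
rewrite -cardsT -sum_bin2_inter -sum_nat_const.
by apply: eq_bigr => b bB; rewrite setIT sizeB.
Qed.

(** Compare the pair counts in [V] and in [V] without [v]: exactly the blocks through [v] lose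
    pairs, [S - 1] each. *)
Lemma replication (v : V) :
  (#|[set b in B | v \in b]| * (S - 1) = Lambda * (m - 1))%N.
Proof.
have h1 := sum_bin2_inter (~: [set v]).
have h2 := block_count.
have cv : (#|~: [set v]| = m - 1)%N by rewrite cardsC1 subn1.
rewrite cv in h1.
have h3 : (\sum_(b in B) 'C(#|b :&: ~: [set v]|, 2) +
   #|[set b in B | v \in b]| * (S - 1) = #|B| * 'C(S, 2))%N.
  rewrite -!sum_nat_const.
  have -> : (\sum_(b in [set b in B | v \in b]) (S - 1) =
     \sum_(b in B) (v \in b) * (S - 1))%N.
    rewrite big_mkcond [RHS]big_mkcond /=; apply: eq_bigr => b _.
    by rewrite inE; case: (b \in B); case: (v \in b); rewrite ?mul1n.
  rewrite -big_split /=; apply: eq_bigr => b bB.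
  have := cardsD1 v b; rewrite setDE sizeB // => ->.
  case: (v \in b); rewrite ?mul1n ?mul0n ?add0n ?addn0 //.
  by rewrite add1n binS bin1 subSS subn0 addnC.
have m0 : (0 < m)%N by apply/card_gt0P; exists v.
have h4 : ('C(m, 2) = 'C(m - 1, 2) + (m - 1))%N.
  by case: m m0 => // k _; rewrite binS bin1 subSS subn0.
rewrite h4 in h2; nia.
Qed.

Lemma sum_card_inter (X : {set V}) :
  ((\sum_(b in B) #|b :&: X|) * (S - 1) = #|X| * (Lambda * (m - 1)))%N.
Proof.
transitivity ((\sum_(v in X) #|[set b in B | v \in b]|) * (S - 1))%N.
  congr (_ * _)%N.
  transitivity (\sum_(b in B) \sum_(v in X) (v \in b : nat))%N.
    apply: eq_bigr => b _; rewrite -sum1_card big_mkcond [RHS]big_mkcond /=.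
    by apply: eq_bigr => v _; rewrite inE; case: (v \in b); case: (v \in X).
  rewrite exchange_big /=; apply: eq_bigr => v _.
  rewrite -sum1_card big_mkcond [RHS]big_mkcond /=.
  by apply: eq_bigr => b _; rewrite inE; case: (b \in B); case: (v \in b).
rewrite big_distrl /= -sum_nat_const; apply: eq_bigr => v _; exact: replication.
Qed.

Section TwoIntersectionNumbers.
Variables al be : int.
Hypothesis S_gt1 : (1 < S)%N.
Hypothesis m_gt1 : (1 < m)%N.
Hypothesis interB : forall b b', b \in B -> b' \in B -> b != b' ->
  (#|b :&: b'|%:Z - al) * (#|b :&: b'|%:Z - be) = 0.

(** Sum [(|b :&: b0| - al) (|b :&: b0| - be)] over all blocks [b]. Only [b = b0] contributes, while
    expanding the product leaves the first two moments of [|b :&: b0|], which the design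
    determines. *)
Lemma quasi_symmetric_block_count (b0 : {set V}) : b0 \in B ->
  let n := #|B|%:Z in let S := S%:Z in let m := m%:Z in
  n * (S ^+ 2 * (S - 1) ^+ 2 + (1 - al - be) * S ^+ 2 * (m - 1)
       + al * be * m * (m - 1)) = m * (m - 1) * (S - al) * (S - be).
Proof.
move=> b0B n s m'.
have h1 := sum_bin2_inter b0; rewrite sizeB // in h1.
have h2 := sum_card_inter b0; rewrite sizeB // in h2.
have h3 := block_count.
pose X := (\sum_(b in B) 'C(#|b :&: b0|, 2))%N.
pose Y := (\sum_(b in B) #|b :&: b0|)%N.
have XY : 2 * X%:Z + (1 - al - be) * Y%:Z + al * be * n = (s - al) * (s - be).
  transitivity (\sum_(b in B) (#|b :&: b0|%:Z - al) * (#|b :&: b0|%:Z - be)).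
    rewrite /X /Y !(big_morph Posz PoszD (erefl _)) !mulr_sumr.
    rewrite /n -sum1_card (big_morph Posz PoszD (erefl _)) mulr_sumr.
    rewrite -!big_split /=; apply: eq_bigr => b _.
    by rewrite mulr2_bin2; ring.
  rewrite (bigD1 b0) //= setIid sizeB // big1 ?addr0 // => b /andP[bB bb0].
  exact: interB.
have {h1} h1 : 2 * X%:Z = s * (s - 1) * Lambda%:Z.
  by rewrite /X h1 PoszM mulrA mulr2_bin2.
have {h2} h2 : Y%:Z * (s - 1) = s * (Lambda%:Z * (m' - 1)).
  by rewrite /Y /s /m'; lia.
have {h3} h3 : n * (s * (s - 1)) = m' * (m' - 1) * Lambda%:Z.
  by have := mulr2_bin2 S; have := mulr2_bin2 #|V|; rewrite /n /s /m'; nia.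
have s1 : s - 1 != 0 by rewrite /s; lia.
have m1 : m' - 1 != 0 by rewrite /m'; lia.
have Ym : Y%:Z * m' = s ^+ 2 * n.
  apply: (mulIf s1); apply: (mulIf m1).
  transitivity (Y%:Z * (s - 1) * m' * (m' - 1)); first by ring.
  rewrite h2.
  transitivity (s * (m' - 1) * (m' * (m' - 1) * Lambda%:Z)); first by ring.
  by rewrite -h3; ring.
transitivity (m' * (m' - 1) * ((s - al) * (s - be))); last by ring.
rewrite -XY h1.
transitivity (s * (s - 1) * (m' * (m' - 1) * Lambda%:Z) +
   (1 - al - be) * (m' - 1) * (Y%:Z * m') + al * be * n * m' * (m' - 1)).
  by rewrite -h3 Ym; ring.
by ring.
Qed.

Lemma tight_quasi_symmetric : #|B| = 'C(m, 2) ->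
  (S%:Z - al) * (S%:Z - be) != 0 ->
  let S := S%:Z in let m := m%:Z in
  S * (S - 2) * (2 * S - 1 - al - be) =
    (m - 2) * (S * (al + be - 1) - 2 * al * be).
Proof.
move=> tight th0 s m'.
(* With [k1], [k2], [k3] as below, [f b] is the expansion of the function
   [S (S - 1) (|b :&: b'| - al) (|b :&: b'| - be)] of [b'] in the functions
   [T \subset b'], [T] a pair.  The pair-block incidence matrix [g] is square,
   so [f] and [g] are inverse to each other up to a scalar on both sides. *)
pose pairT := {T : {set V} | #|T| == 2%N}.
pose k1 := s * (2 * s - 1 - al - be); pose k2 := s * (1 - al - be).
pose k3 := s * (1 - al - be) + 2 * al * be.
pose f (b : block B) (T : pairT) : int :=
  k1 * (val T \subset val b)%:R - k2 * (val T \subset ~: val b)%:R + k3.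
pose g (T : pairT) (b : block B) : int := (val T \subset val b)%:R.
pose c := s * (s - 1) * ((s - al) * (s - be)).
have c0 : c != 0 by rewrite /c !mulf_neq0 // /s; lia.
have cardE : #|{: block B}| = #|{: pairT}|.
  rewrite !card_sig; transitivity #|B|; first by apply: eq_card.
  by rewrite tight -card_draws; apply: eq_card => T; rewrite !inE.
have countT (X : {set V}) :
    \sum_(T : pairT) (val T \subset X)%:R = ('C(#|X|, 2))%:Z.
  rewrite -cards_draws -natr_sum -natz; congr (_%:R).
  rewrite -sum1_card [RHS]big_mkcond /=.
  rewrite (bigID (fun T : {set V} => #|T| == 2%N)) /=.
  rewrite [X in (_ + X)%N]big1 ?addn0.
    rewrite [RHS](reindex_omap (val : pairT -> _) insub) /=; last first.
      by move=> T T2; rewrite insubT.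
    apply: eq_big => [T|T _]; first by rewrite valK eqxx (valP T).
    by rewrite inE (valP T) andbT; case: (_ \subset _).
  by move=> T /negbTE T2; rewrite inE T2 andbF.
(* For [x = |b :&: b'|], the constants are chosen so that [k1 x (x - 1) - k2 (s - x) (s - x - 1) +
   k3 s (s - 1)] equals [2 s (s - 1) (x - al) (x - be)]. *)
have fg (b b' : block B) : \sum_T f b T * g T b' = c * (b == b')%:R.
  transitivity (k1 * ('C(#|val b :&: val b'|, 2))%:Z
    - k2 * ('C(#|~: val b :&: val b'|, 2))%:Z + k3 * ('C(#|val b'|, 2))%:Z).
    rewrite -!countT !mulr_sumr -sumrB -big_split /=.
    apply: eq_bigr => T _; rewrite /f /g !subsetI.
    by case: (_ \subset val b); case: (_ \subset ~: _); case: (_ \subset val b');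
      rewrite /=; ring.
  have two0 : (2 : int) != 0 by [].
  apply: (mulfI two0).
  have cb' : #|val b'| = S by rewrite sizeB // (valP b').
  have e1 := mulr2_bin2 #|val b :&: val b'|.
  have e2 := mulr2_bin2 #|~: val b :&: val b'|.
  have e3 := mulr2_bin2 #|val b'|.
  have e4 : #|~: val b :&: val b'|%:Z = s - #|val b :&: val b'|%:Z.
    have := cardsID (val b) (val b').
    by rewrite setDE cb' setIC [~: _ :&: _]setIC /s; lia.
  transitivity (2 * (s * (s - 1) * ((#|val b :&: val b'|%:Z - al)
    * (#|val b :&: val b'|%:Z - be)))).
    transitivity (k1 * (2 * ('C(#|val b :&: val b'|, 2))%:Z)
      - k2 * (2 * ('C(#|~: val b :&: val b'|, 2))%:Z)
      + k3 * (2 * ('C(#|val b'|, 2))%:Z)).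
      by ring.
    rewrite e1 e2 e3 e4 cb' -/s /k1 /k2 /k3; ring.
  congr (_ * _); have [->|bb'] := eqVneq b b'.
    by rewrite setIid cb' mulr1.
  by rewrite interB ?mulr0 // ?(valP b) ?(valP b').
have gf := scaled_inverse_sum_symz cardE c0 fg.
have [v [w [_ _ vw]]] : exists v w : V, [/\ v \in V, w \in V & v != w].
  exact/card_gt1P.
have T2 : #|[set v; w]| == 2%N by rewrite cards2 vw.
pose T : pairT := exist _ [set v; w] T2.
pose T' y := insubd T [set v; y].
have T'E y : y != v -> val (T' y) = [set v; y].
  by move=> yv; rewrite val_insubd cards2 [v == y]eq_sym yv.
(* The pairs [[set v; y]] differ from [T] but share [v] with it. Each such off-diagonal entry of
   [g f] vanishes, and summing over [y] makes the contribution of a block containing [T] independent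
   of the block. *)
have sum0 : \sum_(y in ~: [set v; w]) \sum_b g T b * f b (T' y) = 0.
  rewrite big1 // => y; rewrite !inE negb_or => /andP[yv yw].
  rewrite gf -val_eqE T'E // [_ == _](_ : _ = false) ?mulr0 //.
  apply/negbTE/eqP => /setP/(_ w); rewrite !inE eqxx orbT.
  by rewrite [w == v]eq_sym (negbTE vw) [w == y]eq_sym (negbTE yw).
have cardT : #|~: [set v; w]|%:Z = m' - 2.
  by have := cardsC [set v; w]; rewrite (eqP T2) /m'; lia.
(* When [b] contains [T], no pair through [v] lies in its complement, so [k2] drops out; [S - 2] of
   the points [y] lie in [b]. *)
have row_sum b : \sum_(y in ~: [set v; w]) g T b * f b (T' y) =
    g T b * (k1 * (s - 2) + (m' - 2) * k3).
  rewrite -mulr_sumr /g /=.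
  case: (boolP (_ \subset _)) => [Tb|]; last by rewrite !mul0r.
  rewrite !mul1r.
  have vb : v \in val b by rewrite (subsetP Tb) // !inE eqxx.
  transitivity (\sum_(y in ~: [set v; w]) (k1 * (y \in val b)%:R + k3)).
    apply: eq_bigr => y; rewrite !inE negb_or => /andP[yv _].
    by rewrite /f T'E // !subUset !sub1set vb inE vb /= mulr0 subr0.
  rewrite big_split /= sumr_const -[k3 *+ _]mulr_natl natz cardT -mulr_sumr.
  congr (_ * _ + _).
  have cb : #|val b| = S by rewrite sizeB // (valP b).
  have := cardsID [set v; w] (val b); rewrite (setIidPr Tb) (eqP T2) cb.
  rewrite -natr_sum natz -[s]/(S%:Z) => <-; rewrite PoszD addrAC subrr add0r.
  congr (Posz _); rewrite -sum1_card [LHS]big_mkcond [RHS]big_mkcond /=.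
  apply: eq_bigr => y _; rewrite !inE.
  by case: (y \in val b); case: (_ || _).
move: sum0; rewrite exchange_big /=.
rewrite (eq_bigr _ (fun b _ => row_sum b)) -mulr_suml => sum0.
(* If no block contained [T], the diagonal entry [c] of [g f] at [T] would be zero. *)
have gT : \sum_b g T b != 0.
  apply: contra c0; rewrite psumr_eq0 => [/allP g0|b _]; last by rewrite ler0n.
  have := gf T T; rewrite eqxx mulr1 => <-.
  rewrite big1 // => b _; have /eqP -> := g0 b (mem_index_enum b).
  exact: mul0r.
move/eqP: sum0; rewrite mulf_eq0 (negbTE gT) /= /k1 /k3 => /eqP sum0.
apply/eqP; rewrite -subr_eq0 -sum0; apply/eqP; ring.
Qed.

End TwoIntersectionNumbers.
End Design.

(** * Euclidean geometry of the embedding *)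

Section EuclideanGeometry.
Variables (R : realType) (d : nat).

Definition sqnorm (u : 'rV[R]_d) : R := \sum_j u 0 j ^+ 2.

Lemma sqnorm_eq0 (u : 'rV[R]_d) : (sqnorm u == 0) = (u == 0).
Proof.
rewrite /sqnorm psumr_eq0 => [|j _]; last exact: sqr_ge0.
apply/allP/eqP => [u0|-> j _]; last by rewrite /= mxE sqrf_eq0 eqxx.
apply/rowP => j; rewrite mxE; apply/eqP.
by rewrite -sqrf_eq0; apply: u0; rewrite mem_index_enum.
Qed.

Lemma edist_sqr (x y : 'rV[R]_d) : edist x y ^+ 2 = sqnorm (x - y).
Proof.
by rewrite /edist /enorm sqr_sqrtr // sumr_ge0 // => j _; apply: sqr_ge0.
Qed.

Lemma edist_sqr_eq0 (x y : 'rV[R]_d) : (edist x y ^+ 2 == 0) = (x == y).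
Proof. by rewrite edist_sqr sqnorm_eq0 subr_eq0. Qed.

Section Simplex.
Variables (I : finType) (p : I -> 'rV[R]_d) (L : R).
Hypothesis p_dist : forall x y, x != y -> edist (p x) (p y) ^+ 2 = L.

(** By polarization, the inner product of [p x] and [p y] is a term in [x] alone plus a term in [y]
    alone plus [L / 2] on the diagonal; the first two vanish against coefficients of sum zero. *)
Lemma simplex_sqnorm (c : I -> R) : \sum_x c x = 0 ->
  sqnorm (\sum_x c x *: p x) = L / 2 * \sum_x c x ^+ 2.
Proof.
move=> c0.
have pD x y : \sum_j p x 0 j * p y 0 j =
    (sqnorm (p x) + sqnorm (p y) - L + L * (x == y)%:R) / 2.
  have -> : L * (x == y)%:R = L - sqnorm (p x - p y).
    have [->|xy] := eqVneq.
      by rewrite subrr mulr1 (eqP (_ : sqnorm 0 == 0)) ?sqnorm_eq0 ?subr0.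
    by rewrite mulr0 -edist_sqr p_dist // subrr.
  rewrite addrA subrK; apply: (canRL (mulfK _)); first by rewrite pnatr_eq0.
  rewrite /sqnorm mulr_suml -big_split -sumrB /=; apply: eq_bigr => j _.
  by rewrite !mxE; ring.
transitivity (\sum_x \sum_y c x * c y * \sum_j p x 0 j * p y 0 j).
  under [RHS]eq_bigr => x _ do under eq_bigr => y _ do rewrite mulr_sumr.
  under [RHS]eq_bigr => x _ do rewrite exchange_big.
  rewrite [RHS]exchange_big; apply: eq_bigr => j _ /=.
  rewrite summxE expr2 big_distrlr /=; apply: eq_bigr => x _.
  by apply: eq_bigr => y _; rewrite !mxE; ring.
transitivity (\sum_x (c x * ((sqnorm (p x) - L) / 2) * \sum_y c y
   + c x * \sum_y c y * (sqnorm (p y) / 2) + L / 2 * c x ^+ 2)).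
  apply: eq_bigr => x _; rewrite !mulr_sumr -!big_split /=.
  have -> : L / 2 * c x ^+ 2 = \sum_y c x * c y * (L * (x == y)%:R / 2).
    rewrite (bigD1 x) //= eqxx big1 => [|y yx]; first by rewrite /= addr0; field.
    by rewrite eq_sym (negbTE yx) mulr0 mul0r mulr0.
  by rewrite -!big_split /=; apply: eq_bigr => y _; rewrite pD; ring.
rewrite !big_split /= -!mulr_suml c0 mul0r -mulr_sumr.
by rewrite mulr0 !add0r.
Qed.

(** Appending a coordinate [1] to each [p x] gives [d + 1] linearly independent rows of length
    [d + 1], which therefore span. *)
Lemma affine_coordinates : affinely_independent p -> #|I| = d.+1 ->
  forall z, exists a : I -> R, \sum_x a x = 1 /\ z = \sum_x a x *: p x.
Proof.
move=> indep cardI z.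
pose A : 'M[R]_(#|I|, d + 1) := \matrix_x row_mx (p (enum_val x)) 1%:M.
have mulA (u : 'rV_#|I|) : u *m A = row_mx (\sum_x u 0 (enum_rank x) *: p x)
    (\sum_x u 0 (enum_rank x))%:M.
  rewrite mulmx_sum_row -scalemx1 scaler_suml.
  rewrite (reindex _ (onW_bij _ (@enum_rank_bij I))) /=.
  under eq_bigr => x _ do rewrite rowK enum_rankK scale_row_mx.
  by elim/big_rec3: _ => [|x a b c _ ->]; rewrite ?row_mx0 // add_row_mx.
have Afree : row_free A.
  apply: inj_row_free => u; rewrite mulA -row_mx0 => /eq_row_mx[e1 e2].
  have e3 : \sum_x u 0 (enum_rank x) = 0.
    by move/matrixP/(_ 0 0): e2; rewrite !mxE mulr1n.
  apply/rowP => x; rewrite mxE -[x]enum_valK.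
  exact: (indep (fun x => u 0 (enum_rank x))).
have Afull : row_full A by rewrite /row_full (eqP Afree) cardI addn1.
have /submxP[u] := submx_full (row_mx z (1%:M : 'M_1)) Afull.
rewrite mulA => /eq_row_mx[e1 e2]; exists (fun x => u 0 (enum_rank x)); split=> //.
by move/matrixP/(_ 0 0): e2; rewrite !mxE mulr1n.
Qed.

End Simplex.
End EuclideanGeometry.

Section Embedding.
Variables (R : realType) (V : finType) (B : {set {set V}}) (S d : nat).
Variables (p : V -> 'rV[R]_d) (q : block B -> 'rV[R]_d) (L D1 D0 : R).
Hypothesis p_indep : affinely_independent p.
Hypothesis cardV : #|V| = d.+1.
Hypothesis p_dist : forall x y, x != y -> edist (p x) (p y) ^+ 2 = L.
Hypothesis L_neq0 : L != 0.
Hypothesis sizeB : forall b, b \in B -> #|b| = S.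
Hypothesis pq_dist : forall v b,
  edist (p v) (q b) ^+ 2 = if v \in val b then D1 else D0.
Local Notation m := (#|V|%:R : R).
Local Notation t := ((D0 - D1) / L).

Let m_neq0 : m != 0. Proof. by rewrite cardV pnatr_eq0. Qed.

Let sum_mem (b : block B) : \sum_v (v \in val b)%:R = S%:R :> R.
Proof. by rewrite -natr_sum -big_mkcond sum1_card sizeB // (valP b). Qed.

Let dist_coordinates (a : V -> R) (w : V) : \sum_v a v = 1 ->
  edist (p w) (\sum_v a v *: p v) ^+ 2 = L / 2 * (1 - 2 * a w + \sum_v a v ^+ 2).
Proof.
move=> a1; rewrite edist_sqr.
have -> : p w - \sum_v a v *: p v = \sum_v ((v == w)%:R - a v) *: p v.
  under [RHS]eq_bigr => v _ do rewrite scalerBl.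
  rewrite sumrB; congr (_ - _).
  rewrite (bigD1 w) //= eqxx scale1r big1 ?addr0 // => v /negbTE ->.
  by rewrite scale0r.
have dw : \sum_v (v == w)%:R = 1 :> R.
  by rewrite (bigD1 w) //= eqxx big1 ?addr0 // => v /negbTE ->.
rewrite (simplex_sqnorm p_dist) ?sumrB ?dw ?a1 ?subrr //; congr (_ * _).
transitivity (\sum_v ((v == w)%:R * (1 - 2 * a w) + a v ^+ 2)).
  apply: eq_bigr => v _; have [->|_] := eqVneq; rewrite /=; ring.
by rewrite big_split /= -mulr_suml dw mul1r.
Qed.

(** The squared distance to the vertex [w] is affine in the coordinate [a w], with the same
    coefficients for all [w]. Hence [a] takes one value on [b] and another off [b], differing by
    [t]; the sum [1] fixes both. *)
Lemma block_coordinates (b : block B) :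
  q b = \sum_v ((1 - S%:R * t) / m + t * (v \in val b)%:R) *: p v.
Proof.
have [a [a1 qa]] := affine_coordinates p_indep cardV (q b).
pose a0 := (1 + \sum_v a v ^+ 2) / 2 - D0 / L.
have aE w : a w = a0 + t * (w \in val b)%:R.
  have := dist_coordinates w a1; rewrite -qa pq_dist /a0.
  by case: (_ \in _) => /= ->; field.
have a0E : a0 = (1 - S%:R * t) / m.
  apply: (canRL (mulfK m_neq0)); apply: (canRL (addrK _)).
  rewrite -[RHS]a1; under [RHS]eq_bigr => v _ do rewrite aE.
  rewrite big_split /= sumr_const -mulr_sumr sum_mem -[a0 *+ _]mulr_natl.
  by rewrite [a0 * _]mulrC [S%:R * _]mulrC.
by rewrite {1}qa; apply: eq_bigr => v _; rewrite aE a0E.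
Qed.

Lemma block_dist (b b' : block B) : edist (q b) (q b') ^+ 2 =
  L * t ^+ 2 * (S%:R - #|val b :&: val b'|%:R).
Proof.
rewrite edist_sqr 2!block_coordinates -sumrB.
under eq_bigr => v _ do rewrite -scalerBl opprD addrACA subrr add0r -mulrBr.
rewrite (simplex_sqnorm p_dist); last first.
  by rewrite -mulr_sumr sumrB !sum_mem subrr mulr0.
have -> : \sum_v (t * ((v \in val b)%:R - (v \in val b')%:R)) ^+ 2 =
    \sum_v t ^+ 2 * ((v \in val b)%:R + (v \in val b')%:R
      - 2 * (v \in val b :&: val b')%:R).
  by apply: eq_bigr => v _; rewrite inE; do 2!case: (_ \in _) => /=; ring.
rewrite -mulr_sumr sumrB big_split /= !sum_mem -mulr_sumr.
rewrite -natr_sum -big_mkcond sum1_card.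
by field.
Qed.

(** Feeding the coordinates back into the distance ties [D0] and [D1] to [L], [t], [S] and [m]; this
    consistency condition later gives the quadratic equation on the parameters. *)
Lemma point_block_dist (v : V) (b : block B) : edist (p v) (q b) ^+ 2 =
  L / 2 * (1 + (1 + t ^+ 2 * S%:R * (m - S%:R)) / m - 2 * (1 - S%:R * t) / m
   - 2 * t * (v \in val b)%:R).
Proof.
have S1 : \sum_v ((1 - S%:R * t) / m + t * (v \in val b)%:R) = 1.
  rewrite big_split /= sumr_const -mulr_sumr sum_mem -mulr_natl.
  by field; rewrite m_neq0 L_neq0.
rewrite block_coordinates dist_coordinates //; congr (_ * _).
have -> : \sum_v ((1 - S%:R * t) / m + t * (v \in val b)%:R) ^+ 2 =
   (1 + t ^+ 2 * S%:R * (m - S%:R)) / m.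
  transitivity (\sum_v (((1 - S%:R * t) / m) ^+ 2 +
    (2 * (1 - S%:R * t) / m * t + t ^+ 2) * (v \in val b)%:R)).
    by apply: eq_bigr => w _; case: (_ \in _) => /=; ring.
  rewrite big_split /= sumr_const -mulr_sumr sum_mem -mulr_natl.
  by field; rewrite m_neq0 L_neq0.
ring.
Qed.

End Embedding.

(** * Nondegeneracy of the spherical embedding and the two distances *)

(** A vector of [U] that also lies in [kermx U^T] is orthogonal to itself, hence zero; so the two
    spaces meet trivially, as [proj_mx_id] requires. *)
Lemma orth_proj_id (R : realType) (d : nat) (U : 'M[R]_d) (u : 'rV[R]_d) :
  (u <= U)%MS -> u *m orth_proj U = u.
Proof.
move=> uU; apply: proj_mx_id => //; apply/eqP; rewrite -submx0.
apply/rV_subP => x; rewrite sub_capmx => /andP[/submxP[a xa] /sub_kermxP xU].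
rewrite submx0 -sqnorm_eq0; apply/eqP.
have : x *m x^T = 0 by rewrite {2}xa trmx_mul mulmxA xU mul0mx.
move/matrixP/(_ 0 0); rewrite !mxE => <-.
by apply: eq_bigr => j _; rewrite mxE expr2.
Qed.

(** The projected basis vectors span the eigenspace, which [phi] maps onto the whole space; if their
    images all coincided, that space would be at most a line. *)
Lemma scaled_spherical_embedding_not_constant (R : realType) (V : finType)
    (B : {set {set V}}) (alpha d : nat) (r : R) (f : block B -> 'rV[R]_d) :
  (1 < d)%N -> scaled_spherical_embedding alpha r f ->
  ~ (forall b b', f b = f b').
Proof.
move=> d1 [o [c [phi [c0 _ surj fE]]]] fconst.
have [z phiz] : exists z, forall b,
    phi (basis_vec R b *m orth_proj (eigenspace (block_adj_mx R B alpha) r)) = z.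
  have [b0|noB] := pickP {: block B}; last by exists 0 => b; have := noB b.
  exists (phi (basis_vec R b0 *m
    orth_proj (eigenspace (block_adj_mx R B alpha) r))) => b.
  have := fconst b b0; rewrite !fE => /addrI.
  by apply: scalerI; rewrite lt0r_neq0.
have line (y : 'rV[R]_d) : (y <= z)%MS.
  have [u uW <-] := surj y.
  rewrite -(orth_proj_id uW) {1}(row_sum_delta u) mulmx_suml linear_sum /=.
  apply: summx_sub => x _; rewrite -scalemxAl linearZ /= scalemx_sub //.
  by have := phiz (enum_val x); rewrite /basis_vec enum_valK => ->.
have : (\rank (1%:M : 'M[R]_d) <= 1)%N.
  by rewrite (leq_trans _ (rank_leq_row z)) // mxrankS //; apply/row_subP.
by rewrite mxrank1 leqNgt d1.
Qed.

Lemma two_distance_set_cases (R : realType) (d : nat) (X : {fset 'rV[R]_d})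
    (x x' y y' z z' : 'rV[R]_d) : two_distance_set X ->
  x \in X -> x' \in X -> y \in X -> y' \in X -> z \in X -> z' \in X ->
  x != x' -> y != y' -> z != z' -> edist x x' != edist y y' ->
  edist z z' = edist x x' \/ edist z z' = edist y y'.
Proof.
move=> X2 xX x'X yX y'X zX z'X xx' yy' zz' xy.
have memD u u' : u \in X -> u' \in X -> u != u' ->
    edist u u' \in distance_set X X.
  move=> uX u'X uu'; apply/imfsetP; exists (u, u') => //=.
  by rewrite !inE /= uX u'X.
have sub : ([fset edist x x'; edist y y'] `<=` distance_set X X)%fset.
  by apply/fsubsetP => e; rewrite !inE => /orP[] /eqP ->; apply: memD.
have /eqP eqD : [fset edist x x'; edist y y']%fset == distance_set X X.
  by rewrite eqEfcard sub /= X2 cardfs2 xy.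
have := memD _ _ zX z'X zz'; rewrite -eqD !inE.
by case/orP => /eqP ->; [left|right].
Qed.

(** * Integrality of the parameters *)

(** As [t != 0], [D0] and [D1] are [X] and [Y] in some order, and their difference [L t] gives
    [1 / t = +- (alpha - beta)]. The sign of [d] is chosen so that [S - d^2] is the intersection
    number of blocks at squared distance [L]; [S1] is [S] if [D1 = L] and [m - S] if [D0 = L]. *)
Lemma integral_parameters (R : realType) (m S alpha beta : nat) (t L D1 D0 : R) :
  (beta < alpha < S)%N -> (0 < m)%N -> 0 < L -> t != 0 -> D0 - D1 = L * t ->
  let X := L * t ^+ 2 * (S%:R - alpha%:R) in
  let Y := L * t ^+ 2 * (S%:R - beta%:R) in
  let D := L / 2 * (1 + (1 + t ^+ 2 * S%:R * (m%:R - S%:R)) / m%:R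
             - 2 * (1 - S%:R * t) / m%:R) in
  D0 = D ->
  L = X \/ L = Y -> D0 = X \/ D0 = Y -> D1 = X \/ D1 = Y ->
  exists d S1 : int, [/\ d != 0, d != -1, S1 = S%:Z \/ S1 = m%:Z - S%:Z,
    (S1 - 2 * d) * (m%:Z - S1) = (m%:Z + 1) * d ^+ 2
  & (alpha%:Z = S%:Z - d ^+ 2 /\ beta%:Z = S%:Z - d ^+ 2 - d) \/
    (beta%:Z = S%:Z - d ^+ 2 /\ alpha%:Z = S%:Z - d ^+ 2 - d)].
Proof.
move=> /andP[ba aS] m0 L0 t0 D01 X Y D eD0 hL h0 h1.
have eD1 : D1 = D - L * t by rewrite -eD0 -D01; ring.
have Ln0 := lt0r_neq0 L0.
have mn0 : m%:R != 0 :> R by rewrite pnatr_eq0 -lt0n.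
have castE := (rmorphM, rmorphB, rmorphD, rmorphXn, rmorph1, rmorph_nat).
(* The equation [D1 = L], cleared of [L / (2 m)] and multiplied by [d^2], becomes integral because
   [t d = 1]. *)
have geo1 (d : int) : t * d%:~R = 1 -> D1 = L ->
    (S%:Z - 2 * d) * (m%:Z - S%:Z) = (m%:Z + 1) * d ^+ 2.
  move=> td D1L; apply: (@intr_inj R).
  have : L / 2 / m%:R * (t ^+ 2 * S%:R * (m%:R - S%:R) - 2 * t * (m%:R - S%:R)
      - m%:R - 1) = 0.
    by transitivity (D1 - L); [rewrite eD1 /D; field | rewrite D1L subrr].
  move/eqP; rewrite !mulf_eq0 !invr_eq0 (negbTE Ln0) (negbTE mn0) pnatr_eq0 /=.
  rewrite !castE /= -!pmulrn => /eqP E0.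
  transitivity ((t * d%:~R) ^+ 2 * S%:R * (m%:R - S%:R)
    - 2 * (t * d%:~R) * d%:~R * (m%:R - S%:R)); first by rewrite td; ring.
  apply/eqP; rewrite -subr_eq0 -[X in _ == X](mulr0 (d%:~R ^+ 2)) -E0.
  by apply/eqP; ring.
have geo0 (d : int) : t * d%:~R = -1 -> D0 = L ->
    ((m%:Z - S%:Z) - 2 * d) * (m%:Z - (m%:Z - S%:Z)) = (m%:Z + 1) * d ^+ 2.
  move=> td D0L; apply: (@intr_inj R).
  have : L / 2 / m%:R * (t ^+ 2 * S%:R * (m%:R - S%:R) + 2 * t * S%:R
      - m%:R - 1) = 0.
    by transitivity (D0 - L); [rewrite eD0 /D; field | rewrite D0L subrr].
  move/eqP; rewrite !mulf_eq0 !invr_eq0 (negbTE Ln0) (negbTE mn0) pnatr_eq0 /=.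
  rewrite !castE /= -!pmulrn => /eqP E0.
  transitivity ((t * d%:~R) ^+ 2 * S%:R * (m%:R - S%:R)
    + 2 * (t * d%:~R) * d%:~R * S%:R); first by rewrite td; ring.
  apply/eqP; rewrite -subr_eq0 -[X in _ == X](mulr0 (d%:~R ^+ 2)) -E0.
  by apply/eqP; ring.
have sq (d : int) (c : nat) : t ^+ 2 * (S%:R - c%:R) = 1 ->
   t * d%:~R = 1 \/ t * d%:~R = -1 -> c%:Z = S%:Z - d ^+ 2.
  move=> e td; have td2 : (t * d%:~R) ^+ 2 = 1.
    by case: td => ->; rewrite ?sqrrN expr1n.
  apply: (@intr_inj R); rewrite !castE /= -!pmulrn.
  transitivity (S%:R - (t * d%:~R) ^+ 2 * (S%:R - c%:R)).
    by rewrite td2; ring.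
  by rewrite exprMn mulrAC e mul1r.
have hX : L = X -> t ^+ 2 * (S%:R - alpha%:R) = 1.
  by rewrite /X -mulrA => h; apply: (mulfI Ln0); rewrite mulr1.
have hY : L = Y -> t ^+ 2 * (S%:R - beta%:R) = 1.
  by rewrite /Y -mulrA => h; apply: (mulfI Ln0); rewrite mulr1.
have dr (a b : nat) : (a%:Z - b%:Z)%:~R = a%:R - b%:R :> R by rewrite rmorphB.
have step (Z1 Z2 : R) (a b : nat) : Z1 = L * t ^+ 2 * (S%:R - a%:R) ->
   Z2 = L * t ^+ 2 * (S%:R - b%:R) -> Z1 - Z2 = L * t -> 
   t * (b%:Z - a%:Z)%:~R = 1.
  move=> e1 e2; rewrite e1 e2 dr => e.
  have Lt0 : L * t != 0 by rewrite mulf_neq0.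
  by apply: (mulfI Lt0); rewrite mulr1 -{2}e; ring.
have flip (a b : nat) : t * (b%:Z - a%:Z)%:~R = 1 -> t * (a%:Z - b%:Z)%:~R = -1.
  by move=> e; rewrite -opprB rmorphN mulrN e.
case: h0 => e0; case: h1 => e1.
- by move/eqP: D01; rewrite e0 e1 subrr eq_sym mulf_eq0 (negbTE Ln0) (negbTE t0).
- have tp := step _ _ _ _ e0 e1 D01; have tn := flip _ _ tp.
  case: hL => eL.
  + exists (alpha%:Z - beta%:Z), (m%:Z - S%:Z).
    have sa := sq _ _ (hX eL) (or_intror tn).
    by split; [lia|lia|right|apply: geo0; rewrite // e0 -eL|left; split; lia].
  + exists (beta%:Z - alpha%:Z), S%:Z.
    have sb := sq _ _ (hY eL) (or_introl tp).
    split; [lia| |left|apply: geo1; rewrite // e1 -eL|right; split; lia] => //.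
    (* [d = -1] would give [beta = S - 1] and hence [alpha = S]. *)
    apply/eqP => dm; rewrite dm in sb; lia.
- have tp := step _ _ _ _ e0 e1 D01; have tn := flip _ _ tp.
  case: hL => eL.
  + exists (alpha%:Z - beta%:Z), S%:Z.
    have sa := sq _ _ (hX eL) (or_introl tp).
    by split; [lia|lia|left|apply: geo1; rewrite // e1 -eL|left; split; lia].
  + exists (beta%:Z - alpha%:Z), (m%:Z - S%:Z).
    have sb := sq _ _ (hY eL) (or_intror tn).
    split; [lia| |right|apply: geo0; rewrite // e0 -eL|right; split; lia] => //.
    apply/eqP => dm; rewrite dm in sb; lia.
- by move/eqP: D01; rewrite e0 e1 subrr eq_sym mulf_eq0 (negbTE Ln0) (negbTE t0).
Qed.

(** * Assembling the classification *)

Lemma affinely_independent_inj (R : realType) (d : nat) (I : finType)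
    (p : I -> 'rV[R]_d) : affinely_independent p -> injective p.
Proof.
move=> indep x y pxy; apply/eqP; apply: contraT => xy.
have del w : \sum_v (v == w)%:R = 1 :> R.
  by rewrite (bigD1 w) //= eqxx big1 ?addr0 // => v /negbTE ->.
have delp w : \sum_v (v == w)%:R *: p v = p w.
  rewrite (bigD1 w) //= eqxx scale1r big1 ?addr0 // => v /negbTE ->.
  by rewrite scale0r.
have := indep (fun v => (v == x)%:R - (v == y)%:R).
under eq_bigr => v _ do rewrite scalerBl.
rewrite !sumrB !del !delp pxy !subrr => /(_ erefl erefl x).
by rewrite eqxx (negbTE xy) subr0 => /eqP; rewrite oner_eq0.
Qed.

Lemma card_inter_lt (T : finType) (A C : {set T}) :
  #|A| = #|C| -> A != C -> (#|A :&: C| < #|A|)%N.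
Proof.
move=> AC; apply: contraR; rewrite -leqNgt => h.
have /eqP IA : A :&: C == A by rewrite eqEcard subsetIl h.
by rewrite eqEcard AC leqnn andbT; apply/setIidPl.
Qed.

Theorem theorem2 (R : realType) (V : finType) (B : {set {set V}})
    (m S Lambda beta alpha : nat) (k r s : R)
    (i : V + block B -> 'rV[R]_m.-1) :
  quasi_symmetric_2design m S Lambda beta alpha B ->
  block_graph_eigenvalues B alpha k r s ->
  regular_simplex (fun v => i (inl v)) ->
  scaled_spherical_embedding alpha r (fun b => i (inr b)) ->
  (forall (v v' : V) (b b' : block B), (v \in val b) = (v' \in val b') ->
     edist (i (inl v)) (i (inr b)) = edist (i (inl v')) (i (inr b'))) ->
  two_distance_set [fset i z | z : V + block B]%fset ->
  m = 9%N /\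
  (B = [set b : {set V} | #|b| == 2%N] \/
   [set ~: b | b in B] = [set b : {set V} | #|b| == 2%N]).
Proof.
case=> -[cardV sizeB pairB] [ba inter [b1 [b1' [b1B b1'B bb1 i1]]]
  [b2 [b2' [b2B b2'B bb2 i2]]]] _ [indep [l lE]] emb dist3 two; subst m.
have aS : (alpha < S)%N.
  by rewrite -i2 -(sizeB _ b2B) card_inter_lt // !sizeB.
(* Since [beta <= S - 2], two blocks meeting in [beta] points cover at least [S + 2] points. *)
have mS : (S + 2 <= #|V|)%N.
  have := cardsUI b1 b1'; rewrite i1 (sizeB _ b1B) (sizeB _ b1'B).
  by have := subset_leq_card (subsetT (b1 :|: b1')); rewrite cardsT; lia.
have S_gt1 : (1 < S)%N by lia.
have V_gt1 : (1 < #|V|)%N by lia.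
have d_gt1 : (1 < #|V|.-1)%N by lia.
have cardV : #|V| = #|V|.-1.+1 by lia.
pose p v := i (inl v); pose q b := i (inr b).
have p_inj : injective p := affinely_independent_inj indep.
have p_dist x y : x != y -> edist (p x) (p y) ^+ 2 = l ^+ 2.
  by move=> xy; rewrite /p lE.
have in_b (b : {set V}) : b \in B ->
    exists v w, [/\ v \in b, w \in b & v != w].
  by move=> bB; apply/card_gt1P; rewrite sizeB //; lia.
have out_b (b : {set V}) : b \in B ->
    exists v w, [/\ v \in ~: b, w \in ~: b & v != w].
  move=> bB; apply/card_gt1P.
  by have := cardsC b; rewrite sizeB //; lia.
have [v1 [w1 [v1b w1b vw1]]] := in_b _ b1B.
have [v0 [w0 [v0b w0b vw0]]] := out_b _ b1B.
rewrite !inE in v0b w0b.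
have L_gt0 : 0 < l ^+ 2.
  rewrite lt0r sqr_ge0 andbT -(p_dist _ _ vw1) edist_sqr_eq0.
  by rewrite (inj_eq p_inj).
pose c1 : block B := exist _ b1 b1B; pose c1' : block B := exist _ b1' b1'B.
pose c2 : block B := exist _ b2 b2B; pose c2' : block B := exist _ b2' b2'B.
pose D1 := edist (p v1) (q c1) ^+ 2; pose D0 := edist (p v0) (q c1) ^+ 2.
have pq_dist v b : edist (p v) (q b) ^+ 2 = if v \in val b then D1 else D0.
  case: ifP => vb; congr (_ ^+ 2); apply: dist3; rewrite vb /= ?v1b //.
  by rewrite (negbTE v0b).
pose t := (D0 - D1) / l ^+ 2.
have L_neq0 := lt0r_neq0 L_gt0.
have qq := block_dist indep cardV p_dist L_neq0 sizeB pq_dist.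
have pq := point_block_dist indep cardV p_dist L_neq0 sizeB pq_dist.
rewrite -/t in qq pq.
have t0 : t != 0.
  apply/eqP => t0.
  apply: (scaled_spherical_embedding_not_constant _ emb) => [|b b'].
    exact: d_gt1.
  by apply/eqP; rewrite -edist_sqr_eq0 qq t0 expr0n mulr0 mul0r.
pose X := l ^+ 2 * t ^+ 2 * (S%:R - alpha%:R).
pose Y := l ^+ 2 * t ^+ 2 * (S%:R - beta%:R).
have qX : edist (q c2) (q c2') ^+ 2 = X by rewrite qq i2.
have qY : edist (q c1) (q c1') ^+ 2 = Y by rewrite qq i1.
have Lt0 : l ^+ 2 * t ^+ 2 != 0 by rewrite mulf_neq0 // expf_neq0.
have X0 : X != 0 by rewrite mulf_neq0 // subr_eq0 eqr_nat gtn_eqF.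
have Y0 : Y != 0.
  by rewrite mulf_neq0 // subr_eq0 eqr_nat gtn_eqF // (ltn_trans ba).
have XY : X != Y.
  by rewrite (inj_eq (mulfI Lt0)) (inj_eq (addrI _)) eqr_opp eqr_nat gtn_eqF.
(* [X] and [Y] are nonzero, different and both attained between blocks, so they exhaust the squared
   distances. *)
have cases z z' : i z != i z' ->
    edist (i z) (i z') ^+ 2 = X \/ edist (i z) (i z') ^+ 2 = Y.
  move=> zz'.
  have iX u : i u \in [fset i z | z : V + block B]%fset by apply: in_imfset.
  rewrite -qX -qY.
  have [||||->|->] := @two_distance_set_cases _ _ _ (q c2) (q c2') (q c1)
    (q c1') (i z) (i z') two (iX _) (iX _) (iX _) (iX _) (iX _) (iX _).
  - by rewrite -edist_sqr_eq0 qX.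
  - by rewrite -edist_sqr_eq0 qY.
  - by [].
  - by apply: contra XY => /eqP e; rewrite -qX -qY e.
  - by left.
  - by right.
have L_cases : l ^+ 2 = X \/ l ^+ 2 = Y.
  by rewrite -(p_dist _ _ vw1); apply: cases; rewrite (inj_eq p_inj).
(* [D1 = 0] would place two different points of [b1] at the image of [b1]; two points outside [b1]
   serve likewise for [D0]. *)
have D1_cases : D1 = X \/ D1 = Y.
  apply: cases; rewrite -edist_sqr_eq0; apply/negP => D10.
  have e1 : p v1 = q c1 by apply/eqP; rewrite -edist_sqr_eq0.
  have e2 : p w1 = q c1.
    by apply/eqP; rewrite -edist_sqr_eq0 pq_dist /= w1b.
  by move/negP: vw1; apply; rewrite -(inj_eq p_inj) e1 e2.
have D0_cases : D0 = X \/ D0 = Y.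
  apply: cases; rewrite -edist_sqr_eq0; apply/negP => D00.
  have e1 : p v0 = q c1 by apply/eqP; rewrite -edist_sqr_eq0.
  have e2 : p w0 = q c1.
    by apply/eqP; rewrite -edist_sqr_eq0 pq_dist /= (negbTE w0b).
  by move/negP: vw0; apply; rewrite -(inj_eq p_inj) e1 e2.
have D01 : D0 - D1 = l ^+ 2 * t by rewrite /t mulrC divfK.
have D0E := pq v0 c1; rewrite /= (negbTE v0b) mulr0 subr0 in D0E.
have [||d [S1 [d0 d1 hS1 geo ab]]] := integral_parameters (m := #|V|)
  (alpha := alpha) (beta := beta) _ _ L_gt0 t0 D01 D0E L_cases D0_cases D1_cases.
- by rewrite ba.
- exact: ltnW.
pose al := S%:Z - d ^+ 2; pose be := S%:Z - d ^+ 2 - d.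
have interB b b' : b \in B -> b' \in B -> b != b' ->
    (#|b :&: b'|%:Z - al) * (#|b :&: b'|%:Z - be) = 0.
  move=> bB b'B bb'; rewrite /al /be; apply/eqP; rewrite mulf_eq0.
  have [->|->] := inter _ _ bB b'B bb'; case: ab => -[ea eb];
    by rewrite -?eb -?ea subrr eqxx ?orbT.
have V_gt1z : 1 < #|V|%:Z by rewrite ltz_nat.
have n0 : 0 < #|B|%:Z by rewrite ltz_nat; apply/card_gt0P; exists b1.
have E1 := quasi_symmetric_block_count sizeB pairB S_gt1 V_gt1 interB b1B.
have [em eS1 en] := tight_parameters d0 d1 n0 V_gt1z hS1 geo E1.
have tight : #|B| = 'C(#|V|, 2) by have := mulr2_bin2 #|V|; clear -en; lia.
have th0 : (S%:Z - al) * (S%:Z - be) != 0.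
  have -> : (S%:Z - al) * (S%:Z - be) = d ^+ 2 * (d * (d + 1)).
    by rewrite /al /be; ring.
  by rewrite !mulf_neq0 ?expf_neq0 // addr_eq0.
have E2 := tight_quasi_symmetric sizeB S_gt1 V_gt1 interB tight th0.
have d_eq1 := tight_parameter_eq1 d0 d1 hS1 em eS1 E2.
subst d; have m9 : #|V| = 9%N by clear -em; lia.
(* At [d = 1] the value of [S1] is [7]. The blocks or their complements are then pairs, and their
   number ['C(9, 2)] leaves no pair out. *)
have S27 : S = 2%N \/ S = 7%N by clear -m9 eS1 hS1; lia.
split=> //; case: S27 => eS; [left|right]; apply/eqP; rewrite eqEcard card_draws.
  by rewrite tight leqnn andbT; apply/subsetP => b bB; rewrite inE sizeB // eS.
rewrite card_imset ?tight ?leqnn ?andbT; last exact: setC_inj.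
apply/subsetP => _ /imsetP[b bB ->]; rewrite inE.
by have := cardsC b; rewrite sizeB // eS m9; clear; lia.
Qed.
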